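(* There is an algorithm which, given a simple Chip Firing Game $C$ whose support graph has no directed cycle, outputs an Abelian Sandpile Model equivalent to $C$. It runs in time linear with respect to the size of the configuration space of $C$.
   Context: A Chip Firing Game (CFG) is played on a finite directed multigraph with an initial configuration $\sigma_0:V\to\mathbb{N}$ of chips. A vertex $v$ with at least one outgoing edge and at least $d^+(v)$ chips may be fired, sending one chip along each outgoing edge. A sink is a vertex with no outgoing edges. The configuration space is the set of configurations reachable from $\sigma_0$, ordered by reachability. The game is convergent if it reaches a final configuration in which no firing is possible. An execution is a firing sequence from the initial configuration to the final one. A convergent CFG is simple if each vertex is fired at most once during an execution. An Abelian Sandpile Model (ASM) is the same game played on a finite undirected multigraph with a distinguished vertex $\bot$ (the sink) that is never fired. A vertex $v\neq\bot$ holding at least as many chips as its degree may be fired, sending one chip along each incident edge. Equivalently, an ASM is a CFG whose support graph is obtained from the undirected graph as follows: each edge $\{u,v\}$ with $u,v\neq\bot$ is replaced by the two directed edges $(u,v)$ and $(v,u)$, and each edge $\{v,\bot\}$ is replaced by the single directed edge $(v,\bot)$. Two convergent games are equivalent if their configuration spaces are isomorphic posets. Standing assumptions: the support graph of $C$ has exactly one sink $\bot$, and every vertex other than $\bot$ is fired during an execution.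
   Formalization: Size of the configuration space means number of configurations times number of vertices (with the bare number the claim fails: edges could not all be read); time is counted in unit-cost steps of a random-access machine with multiplication that is given the matrix of edge multiplicities. *)

(* Defs.v *)
(* World: MathComp (boot only). *)
From mathcomp Require Import all_boot.

Set Implicit Arguments.
Unset Strict Implicit.
Unset Printing Implicit Defensive.

(** * Chip firing games *)

(* The support graph is the directed multigraph on 'I_nvert in which [mult u v]
   is the number of parallel edges from u to v; [init] is the initial
   configuration. *)
Record cfg := Cfg {
  nvert : nat;
  mult : 'I_nvert -> 'I_nvert -> nat;
  init : {ffun 'I_nvert -> nat}
}.

Definition vertex (C : cfg) := 'I_(nvert C).
Definition config (C : cfg) := {ffun 'I_(nvert C) -> nat}.

Section Game.
Variable C : cfg.
Implicit Types (u v : vertex C) (s t : config C) (vs : seq (vertex C)).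

Definition outdeg v : nat := \sum_(u < nvert C) mult v u.

Definition is_sink v : bool := outdeg v == 0.

Definition fireable s v : bool := (0 < outdeg v) && (outdeg v <= s v).

(* Only used when [fireable s v], so that the subtraction never truncates. *)
Definition fire s v : config C :=
  [ffun u => s u - (if u == v then outdeg v else 0) + mult v u].

Fixpoint legal s vs : bool :=
  if vs is v :: vs' then fireable s v && legal (fire s v) vs' else true.

Definition fire_seq s vs : config C := foldl fire s vs.

Definition reach s t : Prop := exists2 vs, legal s vs & fire_seq s vs = t.

Definition final s : Prop := forall v, ~~ fireable s v.

Definition in_space s : Prop := reach (init C) s.

Definition convergent : Prop := exists2 s, in_space s & final s.

Definition execution vs : Prop :=
  legal (init C) vs /\ final (fire_seq (init C) vs).

Definition simple : Prop :=
  convergent /\ forall vs, execution vs -> forall v, count_mem v vs <= 1.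

Definition acyclic : Prop :=
  forall vs, vs != [::] -> ~~ cycle (fun u v => 0 < mult u v) vs.

Definition enumerates_space (cs : seq (config C)) : Prop :=
  uniq cs /\ forall s, s \in cs <-> in_space s.

(* The number of integers written in an explicit description of the
   configuration space, a configuration being the vector of its chip numbers.
   The bare number of configurations can be linear in [nvert C] while a
   quadratic number of edge multiplicities matter to the game. *)
Definition space_size (cs : seq (config C)) : nat := \sum_(s <- cs) nvert C.

End Game.

(* Configuration spaces ordered by [reach]. Antisymmetry, which holds for
   convergent games, is not needed: injectivity is required explicitly. *)
Definition equivalent (C D : cfg) : Prop :=
  [/\ convergent C, convergent D &
      exists f : config C -> config D,
      [/\ forall s, in_space s -> in_space (f s),
          forall s s', in_space s -> in_space s' -> f s = f s' -> s = s',
          forall t, in_space t -> exists2 s, in_space s & f s = t &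
          forall s s', in_space s -> in_space s' ->
            (reach s s' <-> reach (f s) (f s'))]].

(** * Abelian sandpile models *)

(* [amult u v] is the number of edges {u, v}; the multigraph has no loop. *)
Record asm := Asm {
  avert : nat;
  asink : 'I_avert;
  amult : 'I_avert -> 'I_avert -> nat;
  ainit : {ffun 'I_avert -> nat};
  amult_sym : forall u v, amult u v = amult v u;
  amult_irr : forall v, amult v v = 0
}.

Definition asm_cfg (A : asm) : cfg :=
  {| nvert := avert A;
     mult := fun u v => if u == asink A then 0 else amult u v;
     init := ainit A |}.

(** * Algorithms and their running time *)

(* Programs for a random access machine with unit-cost arithmetic on natural
   numbers: finitely many registers (those named in the program), a random
   access memory, and three-address instructions. Registers are named by
   numbers. *)
Inductive binop := Add | Sub | Mul.

Definition eval_binop (o : binop) : nat -> nat -> nat :=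
  match o with Add => addn | Sub => subn | Mul => muln end.

Inductive prog :=
| Skip
| Const (x k : nat)            (* x := k *)
| Op (o : binop) (x y z : nat) (* x := y o z, Sub being truncated *)
| Read (x y : nat)             (* x := memory[y] *)
| Write (x y : nat)            (* memory[x] := y *)
| Seq (p q : prog)
| If (x : nat) (p q : prog)    (* if x != 0 then p else q *)
| While (x : nat) (p : prog).  (* while x != 0 do p *)

Record state := State { reg : nat -> nat; mem : nat -> nat }.

Definition upd (f : nat -> nat) (i k : nat) : nat -> nat :=
  fun j => if j == i then k else f j.

Definition set_reg (m : state) (x k : nat) : state :=
  State (upd (reg m) x k) (mem m).
Definition set_mem (m : state) (a k : nat) : state :=
  State (reg m) (upd (mem m) a k).

(* [exec p m t m']: started in state m, p halts in state m' after t steps. *)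
Inductive exec : prog -> state -> nat -> state -> Prop :=
| exec_skip m : exec Skip m 1 m
| exec_const x k m : exec (Const x k) m 1 (set_reg m x k)
| exec_op o x y z m :
    exec (Op o x y z) m 1 (set_reg m x (eval_binop o (reg m y) (reg m z)))
| exec_read x y m : exec (Read x y) m 1 (set_reg m x (mem m (reg m y)))
| exec_write x y m : exec (Write x y) m 1 (set_mem m (reg m x) (reg m y))
| exec_seq p q m m1 m2 t1 t2 :
    exec p m t1 m1 -> exec q m1 t2 m2 -> exec (Seq p q) m (t1 + t2) m2
| exec_if x p q m m' t :
    exec (if reg m x != 0 then p else q) m t m' -> exec (If x p q) m t.+1 m'
| exec_while_stop x p m : reg m x = 0 -> exec (While x p) m 1 m
| exec_while_loop x p m m1 m2 t1 t2 :
    reg m x <> 0 -> exec p m t1 m1 -> exec (While x p) m1 t2 m2 ->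
    exec (While x p) m (t1 + t2).+1 m2.

(* Number of vertices, initial configuration, multiplicity matrix row by row. *)
Definition encode_cfg (C : cfg) : seq nat :=
  nvert C :: [seq init C v | v <- enum 'I_(nvert C)]
    ++ [seq mult u v | u <- enum 'I_(nvert C), v <- enum 'I_(nvert C)].

(* The same, with the sink after the number of vertices. *)
Definition encode_asm (A : asm) : seq nat :=
  avert A :: nat_of_ord (asink A) :: [seq ainit A v | v <- enum 'I_(avert A)]
    ++ [seq amult u v | u <- enum 'I_(avert A), v <- enum 'I_(avert A)].

(* The input is in memory from address 0 on; everything else is 0. *)
Definition input_state (w : seq nat) : state := State (fun _ => 0) (nth 0 w).

(* Register 0 holds the address from which the output is to be read. *)
Definition has_output (m : state) (w : seq nat) : Prop :=
  forall i, i < size w -> mem m (reg m 0 + i) = nth 0 w i.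

(* Main.v *)
(* Each vertex fires at most once, so a configuration is determined by the set
   of fired vertices, and v can fire once the fired set S satisfies
   sum_(u in S) mult u v >= outdeg v - init v. Let M v = 1 + sum_w mult v w * M w,
   which makes sense without directed cycles, and scale the edges into v by M v:
   a(u, v) = M v * mult u v + M u * mult v u, plus one more edge from every vertex
   to the sink. In the resulting sandpile the chips that v gets back from its
   successors sum to less than M v, so that they never change whether the
   threshold, scaled by M v, is reached; hence both games have the same legal
   firing sequences. The weights are computed by Kahn's topological sorting in
   time quadratic in the number n of vertices, and there are at least n
   configurations since every vertex but the sink is fired. *)
Require Import Defs.
From mathcomp Require Import all_boot zify.

Set Implicit Arguments.
Unset Strict Implicit.
Unset Printing Implicit Defensive.

(** * Programs *)

Fixpoint straight (p : prog) : bool :=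
  match p with
  | Seq p q | If _ p q => straight p && straight q
  | While _ _ => false
  | _ => true
  end.

Fixpoint run (p : prog) (m : state) : state :=
  match p with
  | Const x k => set_reg m x k
  | Op o x y z => set_reg m x (eval_binop o (reg m y) (reg m z))
  | Read x y => set_reg m x (Defs.mem m (reg m y))
  | Write x y => set_mem m (reg m x) (reg m y)
  | Seq p q => run q (run p m)
  | If x p q => if reg m x != 0 then run p m else run q m
  | _ => m
  end.

Fixpoint cost (p : prog) : nat :=
  match p with
  | Seq p q => cost p + cost q
  | If _ p q => (maxn (cost p) (cost q)).+1
  | _ => 1
  end.

Lemma exec_run p m : straight p -> exists2 t, t <= cost p & exec p m t (run p m).
Proof.
elim: p m => //=; try by move=> *; exists 1 => //; constructor.
- move=> p IHp q IHq m /andP[/IHp-/(_ m)[t1 le1 e1] /IHq-/(_ (run p m))[t2 le2 e2]].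
  by exists (t1 + t2); [rewrite leq_add | apply: exec_seq e1 e2].
- move=> x p IHp q IHq m /andP[/IHp-/(_ m)[t1 le1 e1] /IHq-/(_ m)[t2 le2 e2]].
  case: ifP => hx.
    by exists t1.+1; [rewrite ltnS leq_max le1 | apply: exec_if; rewrite hx].
  by exists t2.+1; [rewrite ltnS leq_max le2 orbT | apply: exec_if; rewrite hx].
Qed.

Definition triple (P : state -> Prop) (p : prog) (T : nat) (Q : state -> Prop) :=
  forall m, P m -> exists t m', [/\ exec p m t m', t <= T & Q m'].

Lemma triple_straight (P Q : state -> Prop) p :
  straight p -> (forall m, P m -> Q (run p m)) -> triple P p (cost p) Q.
Proof.
move=> sp PQ m /PQ Qm; have [t le_t e] := exec_run m sp.
by exists t, (run p m).
Qed.

Lemma triple_seq (P Q R : state -> Prop) p q T1 T2 :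
  triple P p T1 R -> triple R q T2 Q -> triple P (Seq p q) (T1 + T2) Q.
Proof.
move=> hp hq m /hp[t1 [m1 [e1 le1 /hq[t2 [m2 [e2 le2 Qm]]]]]].
by exists (t1 + t2), m2; split; rewrite ?leq_add //; apply: exec_seq e1 e2.
Qed.

Lemma triple_weaken (P P' Q Q' : state -> Prop) p T T' :
  triple P p T Q -> (forall m, P' m -> P m) -> (forall m, Q m -> Q' m) ->
  T <= T' -> triple P' p T' Q'.
Proof.
move=> h PP QQ leT m /PP/h[t [m' [e le_t /QQ Qm]]].
by exists t, m'; split=> //; apply: leq_trans leT.
Qed.

Local Notation "p ;; q" := (Seq p q) (at level 60, right associativity).
Local Notation rO := 0 (only parsing).
Local Notation rN := 1 (only parsing).
Local Notation r1 := 2 (only parsing).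
Local Notation rMat := 3 (only parsing).
Local Notation rR := 4 (only parsing).
Local Notation rM := 5 (only parsing).
Local Notation rQ := 6 (only parsing).
Local Notation rB := 7 (only parsing).
Local Notation rF := 8 (only parsing).
Local Notation rT := 9 (only parsing).
Local Notation rP := 10 (only parsing).
Local Notation rI := 11 (only parsing).
Local Notation rIc := 12 (only parsing).
Local Notation rJ := 13 (only parsing).
Local Notation rJc := 14 (only parsing).

Definition for_loop (i c : nat) (p : prog) : prog :=
  Const i 0;; Op Defs.Sub c rN i;;
  While c (p;; Op Add i i r1;; Op Defs.Sub c rN i).

Lemma triple_for (n : nat) (I : nat -> state -> Prop) i c p T :
  2 < i -> i < c ->
  (forall k m, I k m -> reg m rN = n /\ reg m r1 = 1) ->
  (forall k m x, I k m -> I k (set_reg m i x) /\ I k (set_reg m c x)) ->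
  (forall k, k < n -> triple (fun m => I k m /\ reg m i = k) p T
                             (fun m => I k.+1 m /\ reg m i = k)) ->
  triple (I 0) (for_loop i c p) (n * (T + 3) + 3) (I n).
Proof.
move=> lt2i ltic Ifix Iset body.
have loop d k m : k + d = n -> I k m -> reg m i = k -> reg m c = d ->
    exists t m', [/\ exec (While c (p;; Op Add i i r1;; Op Defs.Sub c rN i)) m t m',
                     t <= d * (T + 3) + 1 & I n m'].
  elim: d k m => [|d IHd] k m kdn Ikm mi mc.
    exists 1, m; split=> //; first exact: exec_while_stop.
    by rewrite -kdn addn0.
  have [|t1 [m1 [e1 le1 [I1 m1i]]]] := body k _ m (conj Ikm mi); first by lia.
  set m2 := set_reg m1 i k.+1; set m3 := set_reg m2 c d.
  have [mN m11] := Ifix _ _ I1.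
  have I3 : I k.+1 m3 by apply: (Iset _ _ _ (Iset _ _ _ I1).1).2.
  have m3i : reg m3 i = k.+1.
    by rewrite /m3 /m2 /= /upd eqxx; case: eqP => // h; lia.
  have m3c : reg m3 c = d by rewrite /m3 /= /upd eqxx.
  have [|t2 [m' [e2 le2 In]]] := IHd k.+1 m3 _ I3 m3i m3c; first by lia.
  exists (t1 + (1 + 1) + t2).+1, m'; split=> //; last by lia.
  apply: exec_while_loop e2; first by rewrite mc.
  apply: exec_seq e1 _; apply: (@exec_seq _ _ _ m2).
    by have := exec_op Add i i 2 m1; rewrite /= m1i m11 addn1.
  have := exec_op Defs.Sub c 1 i m2.
  have -> : reg m2 1 = n by rewrite /m2 /= /upd; case: eqP => // h; lia.
  have -> : reg m2 i = k.+1 by rewrite /m2 /= /upd eqxx.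
  by rewrite /= -[n]kdn (_ : k + d.+1 - k.+1 = d) //; lia.
move=> m I0; have [mN m1] := Ifix _ _ I0.
set m2 := set_reg m i 0; set m3 := set_reg m2 c n.
have I3 : I 0 m3 by apply: (Iset _ _ _ (Iset _ _ _ I0).1).2.
have m3i : reg m3 i = 0.
  by rewrite /m3 /m2 /= /upd eqxx; case: eqP => // h; lia.
have m3c : reg m3 c = n by rewrite /m3 /= /upd eqxx.
have [t [m' [e le_t In]]] := loop n 0 m3 erefl I3 m3i m3c.
exists (1 + (1 + t)), m'; split=> //; last by lia.
apply: exec_seq (exec_const _ _ _) _; apply: exec_seq e.
have := exec_op Defs.Sub c 1 i m2.
have -> : reg m2 1 = n by rewrite /m2 /= /upd; case: eqP => // h; lia.
have -> : reg m2 i = 0 by rewrite /m2 /= /upd eqxx.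
by rewrite /= subn0.
Qed.

(** * Kahn's algorithm *)

Section Kahn.
Variables (n : nat) (mu : nat -> nat -> nat).

Definition row v := \sum_(w < n) mu v w.

Hypothesis acyclic_mu : forall U : pred nat, (exists2 v, v < n & U v) ->
  exists v, [/\ v < n, U v & forall w, w < n -> U w -> mu v w = 0].

Lemma sum_ord_iota (F : nat -> nat) : \sum_(w < n) F w = \sum_(w <- iota 0 n) F w.
Proof. by rewrite -(big_mkord xpredT F) /index_iota subn0. Qed.

Lemma perm_filter_iota s : uniq s -> {subset s <= gtn n} ->
  perm_eq [seq w <- iota 0 n | w \in s] s.
Proof.
move=> us sn; apply: uniq_perm => [||w]; rewrite ?filter_uniq ?iota_uniq //.
rewrite mem_filter mem_iota /=.
by case: (boolP (w \in s)) => //= /sn; rewrite inE.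
Qed.

Lemma sum_filter_iota (F : nat -> nat) s : uniq s -> {subset s <= gtn n} ->
  \sum_(w <- iota 0 n | w \in s) F w = \sum_(w <- s) F w.
Proof. by move=> us sn; rewrite -big_filter; apply/perm_big/perm_filter_iota. Qed.

Lemma sum_subset (F : nat -> nat) s : uniq s -> {subset s <= gtn n} ->
  \sum_(w <- s) F w <= \sum_(w < n) F w.
Proof.
move=> us sn; rewrite sum_ord_iota [leqRHS](bigID (fun w => w \in s)) /=.
by rewrite sum_filter_iota // leq_addr.
Qed.

Lemma sum_support (F : nat -> nat) s : uniq s -> {subset s <= gtn n} ->
  (forall w, w < n -> w \notin s -> F w = 0) ->
  \sum_(w < n) F w = \sum_(w <- s) F w.
Proof.
move=> us sn F0; rewrite sum_ord_iota [LHS](bigID (fun w => w \in s)) /=.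
rewrite sum_filter_iota // [X in _ + X]big1_seq ?addn0 //.
by move=> w /andP[ws]; rewrite mem_iota => /F0->.
Qed.

(* The vertices of q are those whose out-edges all lead to processed vertices,
   and the first i of them have been processed. *)
Definition kahn_inv i (rem M : nat -> nat) q :=
  [/\ uniq q,
      forall v, (v \in q) = (v < n) && (rem v == 0),
      forall v, v < n -> rem v + \sum_(w <- take i q) mu v w = row v,
      forall v, v < n -> M v = 1 + \sum_(w <- take i q) mu v w * M w &
      i <= size q].

Definition newly_free (rem : nat -> nat) w k :=
  [seq v <- iota 0 k | (mu v w != 0) && (rem v - mu v w == 0)].

Lemma size_bounded s : uniq s -> {subset s <= gtn n} -> size s <= n.
Proof.
move=> us sn; rewrite -[n in leqRHS](size_iota 0); apply: uniq_leq_size => // v /sn.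
by rewrite mem_iota.
Qed.

Lemma kahn_size_lt i rem M q : kahn_inv i rem M q -> i < n -> i < size q.
Proof.
move=> [uq qE remE _ le_iq] lt_in; rewrite ltn_neqAle le_iq andbT.
apply/eqP => iE; move: remE; rewrite iE take_size => remE.
have [|v [vn vq hv]] := acyclic_mu (U := fun v => v \notin q).
  have /allPn[v] : ~~ all [in q] (iota 0 n).
    apply/negP => /allP/(uniq_leq_size (iota_uniq 0 n)).
    by rewrite size_iota -iE leqNgt lt_in.
  by rewrite mem_iota => vn vq; exists v.
have sq : {subset q <= gtn n} by move=> w; rewrite qE => /andP[].
move: (remE v vn) vq; rewrite /row (sum_support uq sq hv) qE vn /= => h /eqP[].
by apply/eqP; rewrite -(eqn_add2r (\sum_(w <- q) mu v w)) h.
Qed.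

Lemma kahn_le_rem i rem M q v : kahn_inv i rem M q -> i < size q ->
  v < n -> mu v (nth 0 q i) <= rem v.
Proof.
move=> [uq qE remE _ _] ltiq vn.
rewrite -(leq_add2r (\sum_(w <- take i q) mu v w)) remE //.
have -> : mu v (nth 0 q i) + \sum_(w <- take i q) mu v w =
          \sum_(w <- take i.+1 q) mu v w.
  by rewrite (take_nth 0) // -cats1 big_cat big_seq1 addnC.
apply: sum_subset; first exact: take_uniq.
by move=> w /mem_take; rewrite qE => /andP[].
Qed.

Lemma kahn_newly_free i rem M q k : kahn_inv i rem M q -> i < size q -> k <= n ->
  uniq (q ++ newly_free rem (nth 0 q i) k) /\
  {subset q ++ newly_free rem (nth 0 q i) k <= gtn n}.
Proof.
move=> inv ltiq lekn; have [uq qE remE _ _] := inv.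
have nfP v : v \in newly_free rem (nth 0 q i) k -> [/\ v < n & v \notin q].
  rewrite mem_filter mem_iota => /andP[/andP[mu0 _] /= vk].
  have vn : v < n by apply: leq_trans lekn.
  split=> //; rewrite qE vn /= -lt0n; apply: leq_trans (kahn_le_rem inv ltiq vn).
  by rewrite lt0n.
split.
  rewrite cat_uniq uq filter_uniq ?iota_uniq // andbT /=.
  by apply/hasPn => v /nfP[].
by move=> v; rewrite mem_cat => /orP[|/nfP[]//]; rewrite qE => /andP[].
Qed.

Lemma kahn_step i rem M q (w := nth 0 q i) : kahn_inv i rem M q -> i < size q ->
  kahn_inv i.+1 (fun v => rem v - mu v w) (fun v => M v + mu v w * M w)
           (q ++ newly_free rem w n).
Proof.
move=> inv ltiq; have [uq qE remE ME leiq] := inv.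
have [uq' _] := kahn_newly_free inv ltiq (leqnn n).
have takeE : take i.+1 (q ++ newly_free rem w n) = rcons (take i q) w.
  rewrite takel_cat // -/w; exact: take_nth.
have mu0 v : v \in q -> mu v w = 0.
  rewrite qE => /andP[vn /eqP rv0]; apply/eqP; rewrite -leqn0 -rv0.
  exact: kahn_le_rem inv ltiq vn.
split=> //.
- move=> v; rewrite mem_cat mem_filter mem_iota /= qE.
  case: (ltnP v n) => vn /=; rewrite ?andbF ?andbT //.
  have := kahn_le_rem inv ltiq vn; rewrite -/w.
  by case: (rem v) => [|r] //=; case: (mu v w).
- move=> v vn; rewrite takeE -cats1 big_cat big_seq1 -(remE v vn) /=.
  have := kahn_le_rem inv ltiq vn; rewrite -/w; lia.
- move=> v vn; rewrite takeE -cats1 big_cat big_seq1 /= ME // -addnA.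
  rewrite (mu0 w) ?mem_nth // mul0n addn0; congr (_ + (_ + _)).
  by apply: eq_big_seq => u /mem_take uq1; rewrite (mu0 u uq1) mul0n addn0.
- by rewrite size_cat; apply: leq_trans ltiq _; rewrite leq_addr.
Qed.

Lemma kahn_final rem M q : kahn_inv n rem M q ->
  forall v, v < n -> M v = 1 + \sum_(w < n) mu v w * M w.
Proof.
move=> [uq qE _ ME leiq] v vn.
have sq : {subset q <= gtn n} by move=> w; rewrite qE => /andP[].
have /eqP sizeq : size q == n by rewrite eqn_leq leiq size_bounded.
rewrite ME // take_oversize ?sizeq //.
rewrite (sum_support (F := fun w => mu v w * M w) uq sq) // => w wn /negP[].
have [||_ ->] := @uniq_min_size _ q (iota 0 n) uq; rewrite ?mem_iota ?size_iota ?sizeq //.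
by move=> u /sq; rewrite mem_iota.
Qed.

Lemma kahn_init :
  kahn_inv 0 row (fun=> 1) [seq v <- iota 0 n | row v == 0].
Proof.
split=> // [||v _|v _]; rewrite ?take0 ?big_nil ?addn0 ?filter_uniq ?iota_uniq //.
by move=> v; rewrite mem_filter mem_iota andbC.
Qed.
End Kahn.

(** * The translation program *)

(* With n vertices, the input ends before address E = n + 1 + n * n. From E on
   come four arrays of length n: the number of edges towards vertices not yet
   processed, the weights M, the queue of Kahn's algorithm, and the indicator of
   the sink. Register 9 is the tail of the queue, register 10 the address of the
   next matrix entry to write, and registers from 15 on hold temporaries. *)
Definition setup : prog :=
  Const r1 1;; Const 15 0;; Read rN 15;; Op Add rMat rN r1;; Op Mul 16 rN rN;;
  Op Add rR rMat 16;; Op Add rM rR rN;; Op Add rQ rM rN;; Op Add rB rQ rN;;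
  Op Add rO rB rN;; Op Add rF rO r1;; Op Add rF rF r1;; Write rO rN;; Const rT 0.

Definition sums_body : prog :=
  Op Mul 17 rI rN;; Op Add 17 17 rMat;; Op Add 17 17 rJ;; Read 18 17;;
  Op Add 15 15 18;;
  Op Mul 17 rJ rN;; Op Add 17 17 rMat;; Op Add 17 17 rI;; Read 18 17;;
  Op Add 16 16 18.

Definition vertex_init : prog :=
  Op Add 17 rR rI;; Write 17 15;; Op Add 17 rM rI;; Write 17 r1;;
  Op Add 17 rI r1;; Read 18 17;; Op Defs.Sub 18 15 18;;
  Op Add 16 16 r1;; Op Defs.Sub 16 16 18;; Op Add 17 rF rI;; Write 17 16;;
  Const 18 0;; Op Add 17 rB rI;; Write 17 18;;
  If 15 Skip
    (Write 17 r1;; Op Add 17 rQ rT;; Write 17 rI;; Op Add rT rT r1;;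
     Op Add 17 rO r1;; Write 17 rI).

Definition phase_init : prog :=
  for_loop rI rIc
    ((Const 15 0;; Const 16 0);; for_loop rJ rJc sums_body;; vertex_init).

Definition relax_body : prog :=
  Op Mul 17 rJ rN;; Op Add 17 17 rMat;; Op Add 17 17 15;; Read 18 17;;
  Op Add 17 rR rJ;; Read 19 17;; Op Defs.Sub 19 19 18;; Write 17 19;;
  Op Add 17 rM rJ;; Read 20 17;; Op Mul 21 18 16;; Op Add 20 20 21;; Write 17 20;;
  If 18 (If 19 Skip (Op Add 17 rQ rT;; Write 17 rJ;; Op Add rT rT r1)) Skip.

Definition phase_kahn : prog :=
  for_loop rI rIc
    ((Op Add 17 rQ rI;; Read 15 17;; Op Add 17 rM 15;; Read 16 17);;
     for_loop rJ rJc relax_body).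

Definition matrix_body : prog :=
  Op Mul 17 rI rN;; Op Add 17 17 rMat;; Op Add 17 17 rJ;; Read 18 17;;
  Op Add 17 rM rJ;; Read 19 17;; Op Mul 18 18 19;;
  Op Mul 17 rJ rN;; Op Add 17 17 rMat;; Op Add 17 17 rI;; Read 19 17;;
  Op Mul 19 19 15;; Op Add 18 18 19;;
  Op Add 17 rB rJ;; Read 19 17;;
  Op Defs.Sub 20 16 19;; Op Add 18 18 20;; Op Defs.Sub 20 19 16;; Op Add 18 18 20;;
  Write rP 18;; Op Add rP rP r1.

Definition row_setup : prog :=
  Op Add 17 rM rI;; Read 15 17;; Op Add 17 rB rI;; Read 16 17;;
  Op Add 17 rF rI;; Read 18 17;; Op Mul 18 18 15;; Write 17 18.

Definition phase_output : prog :=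
  Op Add rP rF rN;;
  for_loop rI rIc
    (row_setup;; for_loop rJ rJc matrix_body).

Definition translate : prog := setup;; phase_init;; phase_kahn;; phase_output.

Definition phase_init_cost :=
  cost (Const 15 0;; Const 16 0) + cost sums_body + cost vertex_init + 12.

Definition phase_kahn_cost :=
  cost (Op Add 17 rQ rI;; Read 15 17;; Op Add 17 rM 15;; Read 16 17) + cost relax_body + 12.

Definition phase_output_cost := cost row_setup + cost matrix_body + 13.

Definition translate_cost :=
  cost setup + phase_init_cost + phase_kahn_cost + phase_output_cost.

(* A copy of [upd] for the memory, left folded while register reads are
   simplified. *)
Definition updm := upd.

Lemma updm_eq f i k : updm f i k i = k.
Proof. by rewrite /updm /upd eqxx. Qed.

Lemma updm_ne f i k j : j <> i -> updm f i k j = f j.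
Proof. by move=> /eqP/negPf ne; rewrite /updm /upd ne. Qed.

Section SymbolicExecution.
Variables (s : state) (G : Prop) (rg me : nat -> nat).

Lemma run_const x k q :
  (s = run q (State (upd rg x k) me) -> G) ->
  s = run (Const x k;; q) (State rg me) -> G.
Proof. exact. Qed.

Lemma run_op o x y z q :
  (forall a, a = eval_binop o (rg y) (rg z) -> s = run q (State (upd rg x a) me) -> G) ->
  s = run (Op o x y z;; q) (State rg me) -> G.
Proof. exact. Qed.

Lemma run_read x y q :
  (forall a, a = me (rg y) -> s = run q (State (upd rg x a) me) -> G) ->
  s = run (Read x y;; q) (State rg me) -> G.
Proof. exact. Qed.

Lemma run_write x y q :
  (forall a v, a = rg x -> v = rg y -> s = run q (State rg (updm me a v)) -> G) ->
  s = run (Write x y;; q) (State rg me) -> G.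
Proof. exact. Qed.

Lemma run_if x p p' q :
  (rg x <> 0 -> s = run (p;; q) (State rg me) -> G) ->
  (rg x = 0 -> s = run (p';; q) (State rg me) -> G) ->
  s = run (If x p p';; q) (State rg me) -> G.
Proof. by move=> h h0 /=; case: ifP => /eqP; [apply: h | apply: h0]. Qed.

Lemma run_assoc p p' q : (s = run (p;; p';; q) (State rg me) -> G) ->
  s = run ((p;; p');; q) (State rg me) -> G.
Proof. exact. Qed.

Lemma run_done : (s = State rg me -> G) -> s = run Skip (State rg me) -> G.
Proof. exact. Qed.

Lemma run_skip q : (s = run q (State rg me) -> G) ->
  s = run (Skip;; q) (State rg me) -> G.
Proof. exact. Qed.
End SymbolicExecution.

(* The final [Skip] makes every instruction the head of a sequence. *)
Lemma triple_symbolic (P Q : state -> Prop) p : straight p ->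
  (forall rg me s, P (State rg me) -> s = run (p;; Skip) (State rg me) -> Q s) ->
  triple P p (cost p) Q.
Proof. by move=> sp h; apply: triple_straight => // -[rg me] /h; apply. Qed.

Arguments run : simpl never.

Ltac step h :=
  lazymatch goal with
  | |- _ = run Skip _ -> _ => refine (run_done _)
  | |- _ = run (Seq (Seq _ _) _) _ -> _ => refine (run_assoc _)
  | |- _ = run (Seq Skip _) _ -> _ => refine (run_skip _)
  | |- _ = run (Seq (Const _ _) _) _ -> _ => refine (run_const _)
  | |- _ = run (Seq (Op _ _ _ _) _) _ -> _ =>
      refine (run_op _); let a := fresh "a" in let E := fresh "E" in
      intros a E; rewrite /upd /= ?h in E; subst a
  | |- _ = run (Seq (Read _ _) _) _ -> _ =>
      refine (run_read _); let a := fresh "a" in let E := fresh "E" in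
      intros a E; rewrite /upd /= ?h in E
  | |- _ = run (Seq (Write _ _) _) _ -> _ =>
      refine (run_write _); let a := fresh "a" in let E := fresh "E" in
      let v := fresh "v" in let F := fresh "F" in
      intros a v E F; rewrite /upd /= ?h in E; rewrite /upd /= ?h in F; subst a v
  end.

Ltac mem_cases :=
  rewrite /updm /upd;
  repeat match goal with |- context [if ?a == ?b then _ else _] =>
    case: (@eqP _ a b) => ?; try (exfalso; lia) end.

Section Correct.
Variables (n : nat) (inp : nat -> nat) (bot : nat).
Definition iinit v := inp (v + 1).
Definition imult u v := inp (n + 1 + (u * n + v)).

Hypothesis inp0 : inp 0 = n.
Hypothesis bot_lt : bot < n.
Hypothesis bot_sink : forall v, v < n -> (row n imult v == 0) = (v == bot).
Hypothesis acyclic_mu : forall U : pred nat, (exists2 v, v < n & U v) ->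
  exists v, [/\ v < n, U v & forall w, w < n -> U w -> imult v w = 0].

Local Notation aR := (n + 1 + n * n).
Local Notation aM := (aR + n).
Local Notation aQ := (aM + n).
Local Notation aB := (aQ + n).
Local Notation aO := (aB + n).
Local Notation aF := (aO + 1 + 1).

Definition base_init v := \sum_(u < n) imult u v + 1 - (row n imult v - iinit v).

Definition frame m :=
  [seq reg m k | k <- iota 0 9] = [:: aO; n; 1; n + 1; aR; aM; aQ; aB; aF] /\
  forall a, a < aR -> Defs.mem m a = inp a.

Lemma frame_regs rg me : frame (State rg me) ->
  [/\ rg 0 = aO, rg 1 = n, rg 2 = 1 & [/\ rg 3 = n + 1, rg 4 = aR, rg 5 = aM, rg 6 = aQ & 
      rg 7 = aB /\ rg 8 = aF]].
Proof. by case=> /= -[-> -> -> -> -> -> -> -> ->]. Qed.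

Lemma mat_lt u v : u < n -> v < n -> u * n + v < n * n.
Proof.
move=> un vn; apply: (@leq_trans (u.+1 * n)); last by rewrite leq_mul2r un orbT.
by rewrite mulSn addnC ltn_add2r.
Qed.

Lemma frame_mat rg me u v : frame (State rg me) -> u < n -> v < n ->
  me (u * n + (n + 1) + v) = imult u v.
Proof.
move=> [_ /= h] un vn; rewrite h; last by have := mat_lt un vn; lia.
by rewrite /imult; congr inp; lia.
Qed.

Definition init_inv v m :=
  let q := [seq u <- iota 0 v | row n imult u == 0] in
  [/\ frame m,
      [/\ Defs.mem m aO = n, bot < v -> Defs.mem m (aO + 1) = bot,
          reg m rT = size q & forall k, k < size q -> Defs.mem m (aQ + k) = nth 0 q k] &
      forall u, u < v ->
      [/\ Defs.mem m (aR + u) = row n imult u, Defs.mem m (aM + u) = 1,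
          Defs.mem m (aB + u) = (u == bot) & Defs.mem m (aF + u) = base_init u]].

Definition sums_inv v j m :=
  [/\ init_inv v m, reg m rI = v, reg m 15 = \sum_(w < j) imult v w &
      reg m 16 = \sum_(w < j) imult w v].


Lemma setup_correct :
  triple (fun m => m = State (fun=> 0) inp) setup (cost setup) (init_inv 0).
Proof.
apply: triple_symbolic => // rg me s [-> ->]; rewrite /setup.
do 6 step (inp0,inp0).
subst a.
repeat step (inp0,inp0); move=> ->.
split=> //; first split.
- by rewrite /= /upd /=; congr [:: _; _; _; _; _; _; _; _; _]; lia.
- by move=> a lt_a /=; rewrite updm_ne //; lia.
- by split=> //=; rewrite updm_eq.
Qed.

Lemma sums_correct v : v < n ->
  triple (sums_inv v 0) (for_loop rJ rJc sums_body) (n * (cost sums_body + 3) + 3) (sums_inv v n).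
Proof.
move=> vn; apply: triple_for => //.
- by move=> k [rg me] [[/frame_regs[_ /= -> ->]]].
- move=> j jn; apply: triple_symbolic => // rg me s [[inv rI1 s1 s2] rJ1].
  have [fr _ _] := inv; have [h0 h1 h2 [h3 _ _ _ _]] := frame_regs fr.
  move: rI1 rJ1 s1 s2 => /= rI1 rJ1 s1 s2.
  rewrite /sums_body.
  repeat step (h1,h3,rI1,rJ1,s1,s2).
  rewrite (frame_mat fr) // in E; rewrite (frame_mat fr) // in E0.
  by move=> ->; split=> //; split=> //; rewrite /= /upd /= big_ord_recr ?E ?E0.
Qed.

Lemma vertex_init_correct v : v < n ->
  triple (sums_inv v n) vertex_init (cost vertex_init)
         (fun m => init_inv v.+1 m /\ reg m rI = v).
Proof.
move=> vn; apply: triple_symbolic => // rg me s [inv rI1 s1 s2].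
have [fr [mO mO1 tE qE] mem_v] := inv.
have [h0 h1 h2 [h3 h4 h5 h6 [h7 h8]]] := frame_regs fr.
move: rI1 s1 s2 mO mO1 tE qE mem_v => /= rI1 s1 s2 mO mO1 tE qE mem_v.
rewrite /vertex_init; do 14 step (h0,h1,h2,h3,h4,h5,h6,h7,h8,rI1,s1,s2,tE).
have {}E : a = iinit v.
  by rewrite E !updm_ne; [have [_ /= ->] := fr; [congr inp|]|..]; lia.
repeat step (h0,h1,h2,h3,h4,h5,h6,h7,h8,rI1,s1,s2,tE).
have iotaS : iota 0 v.+1 = rcons (iota 0 v) v by rewrite -addn1 iotaD cats1.
apply: run_if; rewrite /upd /= s1 => rowv.
  have rowF : (row n imult v == 0) = false by apply/eqP.
  repeat step I; move=> ->; split=> //; split.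
  - split; first by case: fr.
    by move=> b lt_b /=; mem_cases; case: fr => _ /= ->.
  - have size_q : size [seq u <- iota 0 v | row n imult u == 0] <= v.
      by rewrite size_filter (leq_trans (count_size _ _)) ?size_iota.
    rewrite iotaS filter_rcons rowF /=; split=> //.
    + by mem_cases.
    + move=> botv; mem_cases; apply: mO1.
      by move: (bot_sink vn); rewrite rowF => /esym/eqP; lia.
    + by move=> k lt_k; mem_cases; apply: qE.
  - move=> u; rewrite ltnS leq_eqVlt => /predU1P[->|lt_uv] /=.
      split; mem_cases => //; last by rewrite E.
      by rewrite -bot_sink // rowF.
    by have [? ? ? ?] := mem_v u lt_uv; split; mem_cases.
have rowT : row n imult v == 0 by apply/eqP.
have botE : v = bot by apply/eqP; rewrite -bot_sink.
repeat step (h0,h1,h2,h3,h4,h5,h6,h7,h8,rI1,s1,s2,tE); move=> ->; split=> //.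
have size_q : size [seq u <- iota 0 v | row n imult u == 0] <= v.
  by rewrite size_filter (leq_trans (count_size _ _)) ?size_iota.
split.
- split; first by case: fr.
  by move=> b lt_b /=; mem_cases; case: fr => _ /= ->.
- rewrite iotaS filter_rcons rowT /= size_rcons; split=> //.
  + by mem_cases.
  + by move=> _; mem_cases.
  + by rewrite /upd /= addn1.
  + move=> k; rewrite ltnS nth_rcons => le_k; mem_cases.
      by case: ltnP; lia.
    by rewrite qE ?ifT //; lia.
- move=> u; rewrite ltnS leq_eqVlt => /predU1P[->|lt_uv] /=.
    by split; mem_cases => //; rewrite ?E ?botE ?eqxx.
  by have [? ? ? ?] := mem_v u lt_uv; split; mem_cases.
Qed.

Lemma phase_init_correct :
  triple (init_inv 0) phase_init (phase_init_cost * (n * n)) (init_inv n).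
Proof.
pose T := cost (Const 15 0;; Const 16 0) + ((n * (cost sums_body + 3) + 3) + cost vertex_init).
have h : triple (init_inv 0) phase_init (n * (T + 3) + 3) (init_inv n).
  apply: triple_for => //.
  - by move=> k [rg me] [/frame_regs[_ /= -> ->]].
  - move=> v vn; apply: triple_seq; last first.
      apply: triple_seq; [exact: sums_correct vn | exact: vertex_init_correct vn].
    apply: triple_symbolic => // rg me s [inv rI1].
    by repeat step I; move=> ->; split=> //=; rewrite big_ord0.
apply: triple_weaken h _ _ _ => //.
rewrite /T /phase_init_cost; nia.
Qed.

Definition output_inv m :=
  [/\ Defs.mem m aO = n, Defs.mem m (aO + 1) = bot &
      forall v, v < n -> Defs.mem m (aB + v) = (v == bot) /\ Defs.mem m (aF + v) = base_init v].

Definition repr rem M q m :=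
  [/\ frame m, output_inv m,
      forall v, v < n -> Defs.mem m (aR + v) = rem v /\ Defs.mem m (aM + v) = M v,
      reg m rT = size q & forall k, k < size q -> Defs.mem m (aQ + k) = nth 0 q k].

Definition kahn_loop_inv i m := exists x : (nat -> nat) * (nat -> nat) * seq nat,
  kahn_inv n imult i x.1.1 x.1.2 x.2 /\ repr x.1.1 x.1.2 x.2 m.

Definition relax_inv i rem M q j m :=
  let w := nth 0 q i in
  [/\ repr (fun v => if v < j then rem v - imult v w else rem v)
           (fun v => if v < j then M v + imult v w * M w else M v)
           (q ++ newly_free imult rem w j) m,
      reg m rI = i, reg m 15 = w & reg m 16 = M w].

Lemma repr_ext rem rem' M M' q m :
  (forall v, v < n -> rem v = rem' v /\ M v = M' v) ->
  repr rem M q m -> repr rem' M' q m.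
Proof.
move=> eq_rM [fr out rM tE qE]; split=> // v vn.
by have [<- <-] := eq_rM v vn; apply: rM.
Qed.

Lemma relax_body_correct i rem M q j : kahn_inv n imult i rem M q -> i < n -> j < n ->
  triple (fun m => relax_inv i rem M q j m /\ reg m rJ = j) relax_body (cost relax_body)
         (fun m => relax_inv i rem M q j.+1 m /\ reg m rJ = j).
Proof.
move=> inv lt_in jn; have lt_iq := kahn_size_lt acyclic_mu inv lt_in.
set w := nth 0 q i.
have wn : w < n.
  by have [_ qE _ _ _] := inv; have := mem_nth 0 lt_iq; rewrite qE => /andP[].
apply: triple_symbolic => // rg me s [[[fr out rM tE qE] rI1 rw rMw] rJ1].
have [h0 h1 h2 [h3 h4 h5 h6 [h7 h8]]] := frame_regs fr.
have [mO mO1 mBF] := out.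
move: rI1 rw rMw rJ1 tE qE rM mO mO1 mBF => /= rI1 rw rMw rJ1 tE qE rM mO mO1 mBF.
have [] := rM j jn; rewrite ltnn => remj Mj.
rewrite /relax_body; repeat step (h0,h1,h2,h3,h4,h5,h6,h7,h8,rI1,rw,rMw,rJ1,tE).
rewrite -/w (frame_mat fr) // in E; rewrite {}remj in E0.
have {}E1 : a1 = M j by rewrite E1 updm_ne //; lia.
subst a a0 a1.
rewrite -/w in rM tE qE rw rMw *.
set me' := updm (updm me _ _) _ _.
set qj := q ++ newly_free imult rem w j in tE qE *.
have [u_qj lt_qj] := kahn_newly_free inv lt_iq (ltnW jn).
have size_qj : size qj <= n := size_bounded u_qj lt_qj.
have newS : newly_free imult rem w j.+1 =
    if (imult j w != 0) && (rem j - imult j w == 0) then rcons (newly_free imult rem w j) j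
    else newly_free imult rem w j.
  by rewrite /newly_free -addn1 iotaD cats1 filter_rcons.
have inp' a : a < aR -> me' a = inp a.
  by move=> lt_a; rewrite /me'; mem_cases; case: fr => _ /= ->.
have rM' v : v < n ->
    me' (aR + v) = (if v < j.+1 then rem v - imult v w else rem v) /\
    me' (aM + v) = (if v < j.+1 then M v + imult v w * M w else M v).
  move=> vn; have [remv Mv] := rM v vn; rewrite ltnS leq_eqVlt.
  rewrite /me' /updm /upd !eqn_add2l; case: (v =P j) => [->|ne_vj] /=; last by split; mem_cases.
  by split => //; case: eqP => //; lia.
have high a : aQ <= a -> me' a = me a by move=> ?; rewrite /me'; mem_cases.
have out' me2 : (forall a, aB <= a -> me2 a = me' a) ->
    output_inv (State (fun=> 0) me2).
  move=> same; split=> /=; try by rewrite same ?high //; lia.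
  move=> v vn; have [mB mF] := mBF v vn.
  by split; rewrite same ?high //; lia.
apply: run_if => hx; last first.
  have {}hx : imult j w = 0 := hx.
  repeat step I; move=> ->; split=> //; split=> //; split.
  - by split=> //; case: fr.
  - exact: out'.
  - exact: rM'.
  - by rewrite newS hx eqxx.
  - rewrite newS hx eqxx => k lt_k; rewrite [LHS]high ?qE //; lia.
have {}hx : imult j w <> 0 := hx.
apply: run_if => hr.
  have {}hr : rem j - imult j w <> 0 := hr.
  repeat step I; move=> ->; split=> //; split=> //; split.
  - by split=> //; case: fr.
  - exact: out'.
  - exact: rM'.
  - by rewrite newS andbC (introF eqP hr).
  - rewrite newS andbC (introF eqP hr) => k lt_k; rewrite [LHS]high ?qE //; lia.
have {}hr : rem j - imult j w = 0 := hr.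
have newT : (imult j w != 0) && (rem j - imult j w == 0) by apply/andP; split; apply/eqP.
have lt_qn : size qj < n.
  have [] := kahn_newly_free inv lt_iq jn; rewrite -/w newS newT -rcons_cat => u_q lt_q.
  by have := size_bounded u_q lt_q; rewrite size_rcons.
repeat step (h0,h1,h2,h3,h4,h5,h6,h7,h8,rI1,rw,rMw,rJ1,tE).
move=> ->; split=> //; split=> //; split.
- split; first by case: fr.
  by move=> a lt_a /=; rewrite updm_ne ?inp' //; lia.
- by apply: (out' (updm me' (aQ + size qj) j)) => a lt_a; rewrite updm_ne //; lia.
- by move=> v vn /=; have [? ?] := rM' v vn; rewrite !updm_ne //; lia.
- by rewrite newS newT -rcons_cat size_rcons /= /upd /= addn1.
- rewrite newS newT -rcons_cat size_rcons -/qj => k; rewrite ltnS nth_rcons /= -/qj => le_k.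
  case: ltnP => [lt_k|].
    rewrite updm_ne ?high ?qE //; lia.
  move=> ge_k; have -> : k = size qj by apply/eqP; rewrite eqn_leq le_k.
  by rewrite updm_eq eqxx.
Qed.

Lemma phase_kahn_correct :
  triple (init_inv n) phase_kahn (phase_kahn_cost * (n * n)) (kahn_loop_inv n).
Proof.
pose p := Op Add 17 rQ rI;; Read 15 17;; Op Add 17 rM 15;; Read 16 17.
pose T := cost p + (n * (cost relax_body + 3) + 3).
have h : triple (kahn_loop_inv 0) phase_kahn (n * (T + 3) + 3) (kahn_loop_inv n).
  apply: triple_for => //.
  - by move=> k [rg me] [x [_ [/frame_regs[_ /= -> ->]]]].
  - move=> i lt_in.
    suff hx (x : (nat -> nat) * (nat -> nat) * seq nat) :
        triple (fun m => [/\ kahn_inv n imult i x.1.1 x.1.2 x.2,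
                             repr x.1.1 x.1.2 x.2 m & reg m rI = i])
          (p;; for_loop rJ rJc relax_body) T
          (fun m => kahn_loop_inv i.+1 m /\ reg m rI = i).
      by move=> m [[x [inv rep]] rI1]; apply: (hx x).
    case: x => [[rem M] q] /=.
    move=> m [inv rep rI1]; have lt_iq := kahn_size_lt acyclic_mu inv lt_in.
    have wn : nth 0 q i < n.
      by have [_ qE _ _ _] := inv; have := mem_nth 0 lt_iq; rewrite qE => /andP[].
    have := triple_seq (P := fun m => repr rem M q m /\ reg m rI = i) (p := p)
       (q := for_loop rJ rJc relax_body) (R := relax_inv i rem M q 0)
       (Q := relax_inv i rem M q n).
    case/(_ (cost p) (n * (cost relax_body + 3) + 3) _ _ m) => //.
    + apply: triple_symbolic => // {rep rI1} rg me s [[fr out rM tE qE] rI1].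
      have [h0 h1 h2 [h3 h4 h5 h6 [h7 h8]]] := frame_regs fr.
      move: rI1 tE qE rM => /= rI1 tE qE rM.
      rewrite /p; repeat step (h0,h1,h2,h3,h4,h5,h6,h7,h8,rI1,tE).
      rewrite {}E qE // (rM _ wn).2 in E0 *.
      by move=> ->; split=> //; rewrite /newly_free cats0.
    + apply: triple_for => //.
      * by move=> k [rg me] [[/frame_regs[_ /= -> ->]]].
      * by move=> j jn; apply: relax_body_correct.
    + move=> t [m' [e le_t [rep' rI1' _ _]]].
      exists t, m'; split=> //; split=> //.
      exists ((fun v => rem v - imult v (nth 0 q i)),
              (fun v => M v + imult v (nth 0 q i) * M (nth 0 q i)),
              q ++ newly_free imult rem (nth 0 q i) n) => /=; split; first exact: kahn_step.
      by apply: repr_ext rep' => v ->.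
apply: triple_weaken h _ _ _ => //; last by rewrite /T /phase_kahn_cost -/p; nia.
move=> m [fr [mO mO1 tE qE] arr].
exists (row n imult, (fun=> 1), [seq v <- iota 0 n | row n imult v == 0]) => /=.
split; first exact: kahn_init.
split=> //; first split=> //; try by move=> v /arr[].
by apply: mO1.
Qed.

Definition entry (M : nat -> nat) u v :=
  imult u v * M v + imult v u * M u + ((u == bot) - (v == bot)) + ((v == bot) - (u == bot)).

Definition output_loop_inv M u p m :=
  [/\ frame m,
      Defs.mem m aO = n /\ Defs.mem m (aO + 1) = bot,
      forall v, v < n ->
      [/\ Defs.mem m (aM + v) = M v, Defs.mem m (aB + v) = (v == bot) &
          Defs.mem m (aF + v) = if v < u then base_init v * M v else base_init v],
      reg m rP = aF + n + p &
      forall k, k < p -> Defs.mem m (aF + n + k) = entry M (k %/ n) (k %% n)].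

Lemma matrix_body_correct M u j : u < n -> j < n ->
  triple (fun m => [/\ output_loop_inv M u.+1 (u * n + j) m, reg m rI = u, reg m 15 = M u
                     & reg m 16 = (u == bot)] /\ reg m rJ = j)
         matrix_body (cost matrix_body)
         (fun m => [/\ output_loop_inv M u.+1 (u * n + j.+1) m, reg m rI = u, reg m 15 = M u
                     & reg m 16 = (u == bot)] /\ reg m rJ = j).
Proof.
move=> un jn; apply: triple_symbolic => // rg me s [[inv rI1 r15 r16] rJ1].
have [fr [mO mO1] arr pE done_] := inv.
have [h0 h1 h2 [h3 h4 h5 h6 [h7 h8]]] := frame_regs fr.
move: rI1 r15 r16 rJ1 mO mO1 arr pE done_ => /= rI1 r15 r16 rJ1 mO mO1 arr pE done_.
rewrite /matrix_body; repeat step (h0,h1,h2,h3,h4,h5,h6,h7,h8,rI1,r15,r16,rJ1,pE).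
have [Mj Bj _] := arr j jn.
rewrite (frame_mat fr) // in E; rewrite (frame_mat fr) // in E1.
rewrite {}Mj in E0; rewrite {}Bj in E2; subst a a0 a1 a2.
move=> ->; split=> //; split=> //; split=> //=.
- split; first by case: fr.
  by move=> a lt_a /=; mem_cases; case: fr => _ /= ->.
- by split; mem_cases.
- by move=> v vn; have [? ? ?] := arr v vn; split; mem_cases.
- by rewrite /upd /=; lia.
- rewrite addnS => k; rewrite ltnS leq_eqVlt => /predU1P[->|lt_k].
    rewrite updm_eq divnMDl ?modnMDl; last lia.
    by rewrite divn_small // modn_small // addn0 /entry.
  by mem_cases; apply: done_.
Qed.

Lemma row_setup_correct M u : u < n ->
  triple (fun m => output_loop_inv M u (u * n) m /\ reg m rI = u) row_setup (cost row_setup)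
         (fun m => [/\ output_loop_inv M u.+1 (u * n + 0) m, reg m rI = u, reg m 15 = M u
                     & reg m 16 = (u == bot)]).
Proof.
move=> un; apply: triple_symbolic => // rg me s [inv rI1].
have [fr [mO mO1] arr pE done_] := inv.
have [h0 h1 h2 [h3 h4 h5 h6 [h7 h8]]] := frame_regs fr.
move: rI1 mO mO1 arr pE done_ => /= rI1 mO mO1 arr pE done_.
rewrite /row_setup; repeat step (h0,h1,h2,h3,h4,h5,h6,h7,h8,rI1,pE).
have [Mu Bu] := arr u un; rewrite ltnn => Fu.
rewrite {}Mu in E; rewrite {}Bu in E0; rewrite {}Fu in E1; subst a a0 a1.
move=> ->; split=> //; rewrite addn0; split=> //=.
- split; first by case: fr.
  by move=> a lt_a /=; mem_cases; case: fr => _ /= ->.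
- by split; mem_cases.
- move=> v vn; have := arr v vn; rewrite ltnS [v <= u]leq_eqVlt.
  case: (v =P u) => [->|ne_vu] /= [? ? ?]; first by split; mem_cases.
  by split; mem_cases.
- by move=> k lt_k; mem_cases; apply: done_.
Qed.

Lemma phase_output_correct M :
  triple (fun m => exists p, output_loop_inv M 0 0 (set_reg m rP p)) phase_output
         (phase_output_cost * (n * n)) (output_loop_inv M n (n * n)).
Proof.
pose T := cost row_setup + (n * (cost matrix_body + 3) + 3).
have h : triple (output_loop_inv M 0 (0 * n))
    (for_loop rI rIc (row_setup;; for_loop rJ rJc matrix_body))
    (n * (T + 3) + 3) (output_loop_inv M n (n * n)).
  apply: (triple_for (I := fun u => output_loop_inv M u (u * n))) => //.
  - by move=> k [rg me] [/frame_regs[_ /= -> ->]].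
  - move=> u un; apply: triple_seq; first exact: row_setup_correct.
    pose J j m := [/\ output_loop_inv M u.+1 (u * n + j) m, reg m rI = u, reg m 15 = M u
                     & reg m 16 = (u == bot)].
    have hJ : triple (J 0) (for_loop rJ rJc matrix_body) (n * (cost matrix_body + 3) + 3) (J n).
      apply: triple_for => //.
      + by move=> k [rg me] [[/frame_regs[_ /= -> ->]]].
      + by move=> j jn; apply: matrix_body_correct.
    apply: triple_weaken hJ _ _ _ => // m [inv rI1 _ _].
    by rewrite mulSn addnC; split.
have h0 : triple (fun m => exists p, output_loop_inv M 0 0 (set_reg m rP p)) (Op Add rP rF rN)
    (cost (Op Add rP rF rN)) (output_loop_inv M 0 (0 * n)).
  apply: triple_symbolic => // rg me s [p inv]; have [fr ? ? _ ?] := inv.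
  have [h0 h1 h2 [h3 h4 h5 h6 [h7 h8]]] := frame_regs fr.
  move: h1 h8; rewrite /upd /= => h1 h8; step (h1, h8); step (h1, h8); move=> ->.
  by split=> //=; rewrite /upd /= mul0n addn0.
apply: triple_weaken (triple_seq h0 h) _ _ _ => //.
by rewrite /T /phase_output_cost /=; nia.
Qed.

Lemma translate_correct : exists t m M,
  [/\ exec translate (State (fun=> 0) inp) t m,
      t <= translate_cost * (n * n),
      forall v, v < n -> M v = 1 + \sum_(w < n) imult v w * M w &
      output_loop_inv M n (n * n) m].
Proof.
have [t1 [m1 [e1 le1 inv1]]] := setup_correct erefl.
have [t2 [m2 [e2 le2 inv2]]] := phase_init_correct inv1.
have [t3 [m3 [e3 le3 [[[rem M] q] /= [inv3 rep3]]]]] := phase_kahn_correct inv2.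
have inv3' : exists p, output_loop_inv M 0 0 (set_reg m3 rP p).
  have [fr [mO mO1 mBF] arr _ _] := rep3; exists (aF + n + 0); split=> // v vn.
  by have [? ?] := mBF v vn; have [_ ?] := arr v vn.
have [t4 [m4 [e4 le4 inv4]]] := phase_output_correct inv3'.
exists (t1 + (t2 + (t3 + t4))), m4, M; split=> //.
- by apply: exec_seq e1 (exec_seq e2 (exec_seq e3 e4)).
- have n2 : 0 < n * n by rewrite muln_gt0; lia.
  have le0 : t1 <= cost setup * (n * n) by apply: leq_trans le1 _; rewrite leq_pmulr.
  rewrite /translate_cost; move: le0 le2 le3 le4; clear.
  move: (cost setup) phase_init_cost phase_kahn_cost phase_output_cost (n * n).
  by move=> c1 c2 c3 c4 N; lia.
- exact: kahn_final inv3.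
Qed.
End Correct.

(** * Equivalence of the two games *)

Lemma sum_seq_count (T : finType) (F : T -> nat) (vs : seq T) :
  \sum_(v <- vs) F v = \sum_v count_mem v vs * F v.
Proof.
elim: vs => [|v vs IH] /=; first by rewrite big_nil big1.
rewrite big_cons IH; under [RHS]eq_bigr => u _ do rewrite mulnDl.
rewrite big_split /=; congr (_ + _).
rewrite (bigD1 v) //= eqxx mul1n big1 ?addn0 // => u.
by rewrite eq_sym => /negPf->.
Qed.

Lemma acyclic_maximal (T : finType) (e : rel T) (A : {pred T}) x0 :
  (forall vs, vs != [::] -> ~~ cycle e vs) -> x0 \in A ->
  exists2 x, x \in A & forall y, y \in A -> ~~ e x y.
Proof.
move=> acyc A0.
pose f x := odflt x [pick y in A | e x y].
case: (boolP [exists x in A, [forall y in A, ~~ e x y]]) => [/exists_inP[x Ax /forall_inP h]|].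
  by exists x.
move/exists_inPn => noMax.
have fP x : x \in A -> (f x \in A) && e x (f x).
  move/noMax/forall_inPn => [y Ay exy]; rewrite /f; case: pickP => [z //|/(_ y)].
  by rewrite negbK in exy; rewrite Ay exy.
have iterA k : iter k f x0 \in A by elim: k => //= k /fP/andP[].
have e_path x k : x \in A -> path e x (traject f (f x) k).
  by elim: k x => //= k IH x /fP/andP[Afx ->]; apply: IH.
have := looping_order f x0; rewrite /looping => /trajectP[i lt_i eq_i].
set y := iter i f x0 in eq_i; set k := (order f x0 - i).-1.
have yk : iter k.+1 f y = y.
  by rewrite -[RHS]eq_i -iterD; congr (iter _ f x0); lia.
have := acyc (traject f y k.+1) isT.
have closes : traject f (f y) k.+1 = rcons (traject f (f y) k) y.
  by rewrite trajectSr -iterSr yk.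
by rewrite /= -closes e_path ?iterA.
Qed.

Section Firing.
Variable C : cfg.
Implicit Types (s t : config C) (u v : vertex C) (vs ws : seq (vertex C)).

Lemma legal_cat s vs ws :
  legal s (vs ++ ws) = legal s vs && legal (fire_seq s vs) ws.
Proof. by elim: vs s => //= v vs IH s; rewrite IH andbA. Qed.

Lemma legal_rcons s vs v :
  legal s (rcons vs v) = legal s vs && fireable (fire_seq s vs) v.
Proof. by rewrite -cats1 legal_cat /= andbT. Qed.

Lemma fire_seq_chips s vs u : legal s vs ->
  fire_seq s vs u + count_mem u vs * outdeg u = s u + \sum_(v <- vs) mult v u.
Proof.
elim: vs s => [|v vs IH] s /=; first by rewrite big_nil mul0n.
case/andP => /andP[_ le_v] /IH; rewrite big_cons ffunE.
case: (eqVneq v u) => [<-|_] /=; last by rewrite subn0; lia.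
by rewrite mulnDl mul1n; lia.
Qed.

Lemma least_action s vs es : legal s vs -> legal s es -> final (fire_seq s es) ->
  forall v, count_mem v vs <= count_mem v es.
Proof.
move=> + les fin; elim/last_ind: vs => [//|vs v IH].
rewrite legal_rcons => /andP[lvs fv] u; have {}IH := IH lvs.
rewrite -cats1 count_cat /= addn0; case: eqP => [<-|_]; last by rewrite addn0.
rewrite addn1 ltn_neqAle IH andbT; apply/eqP => eq_c.
have /negP[] := fin v; move: fv => /andP[d0 dv]; rewrite /fireable d0 /=.
have := fire_seq_chips v lvs; have := fire_seq_chips v les.
have : \sum_(w <- vs) mult w v <= \sum_(w <- es) mult w v.
  by rewrite (sum_seq_count _ vs) (sum_seq_count _ es) leq_sum // => w _; rewrite leq_mul2r IH orbT.
rewrite eq_c => le_sum chips_es chips_vs.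
rewrite -(leq_add2r (count_mem v es * outdeg v)) chips_es.
apply: leq_trans (leq_add (leqnn (s v)) le_sum); by rewrite -chips_vs leq_add2r.
Qed.

End Firing.

Section Equivalence.
Variables (C : cfg) (bot : vertex C).
Hypothesis simple_C : simple C.
Hypothesis acyclic_C : acyclic C.
Hypothesis sink_bot : forall v : vertex C, is_sink v <-> v = bot.
Hypothesis all_fired : forall v : vertex C, v <> bot ->
  exists2 vs : seq (vertex C), execution vs & v \in vs.
Implicit Types (u v w : vertex C) (vs ws : seq (vertex C)).

Lemma execution_exists : exists es : seq (vertex C), execution es.
Proof. by have [[s [es les <-] fin] _] := simple_C; exists es. Qed.

Lemma outdeg_bot : outdeg bot = 0.
Proof. by apply/eqP/sink_bot. Qed.

Lemma outdeg_gt0 v : v != bot -> 0 < outdeg v.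
Proof. by move=> /eqP ne; rewrite lt0n; apply/negP => /sink_bot. Qed.

Lemma legal_uniq vs : legal (init C) vs -> uniq vs /\ bot \notin vs.
Proof.
move=> lvs; split.
  have [es exe] := execution_exists; have [les fin] := exe.
  apply/count_mem_uniq => v; have := least_action lvs les fin v.
  have := simple_C.2 es exe v; rewrite -has_pred1 has_count.
  by case: (count_mem v vs) => [|[|k]] //; lia.
elim/last_ind: vs lvs => // vs v IH; rewrite legal_rcons => /andP[/IH bvs /andP[d _]].
rewrite mem_rcons inE negb_or bvs andbT; apply: contraTneq d => <-.
by rewrite outdeg_bot.
Qed.

Lemma execution_mem es v : execution es -> v != bot -> v \in es.
Proof.
move=> [les fin] /eqP/all_fired[vs [lvs _]].
rewrite -!has_pred1 !has_count => v_vs.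
exact: leq_trans v_vs (least_action lvs les fin v).
Qed.

Lemma threshold_le_indeg v : v != bot -> outdeg v <= init C v + \sum_(u < nvert C) mult u v.
Proof.
move=> vb; have [es exe] := execution_exists.
have [uu _] := legal_uniq exe.1.
have /splitPr v_es := execution_mem exe vb; case: v_es exe uu => e1 e2 [les _] uu.
move: les; rewrite legal_cat /= => /and3P[l1 /andP[_ dv] _].
have := fire_seq_chips v l1.
have : \sum_(u <- e1) mult u v <= \sum_(u < nvert C) mult u v.
  rewrite sum_seq_count leq_sum // => u _.
  have u1 : uniq e1 by move: uu; rewrite cat_uniq => /andP[].
  by rewrite count_uniq_mem //; case: (u \in e1); rewrite ?mul1n.
move=> le_sum chips; apply: leq_trans dv _.
apply: leq_trans (leq_addr (count_mem v e1 * outdeg v) _) _.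
by rewrite chips leq_add2l.
Qed.

Section Weights.
Variable M : vertex C -> nat.
Hypothesis weightE : forall v, M v = 1 + \sum_(w < nvert C) mult v w * M w.

Definition asm_mult u v :=
  mult u v * M v + mult v u * M u + ((u == bot) - (v == bot)) + ((v == bot) - (u == bot)).

Definition asm_init : config C :=
  [ffun v => (\sum_(u < nvert C) mult u v + 1 - (outdeg v - init C v)) * M v].

Lemma asm_mult_sym u v : asm_mult u v = asm_mult v u.
Proof. rewrite /asm_mult; lia. Qed.

Lemma mult_irr v : mult v v = 0.
Proof.
apply/eqP; have := @acyclic_C [:: v] isT; rewrite /= andbT lt0n negbK //.
Qed.

Lemma asm_mult_irr v : asm_mult v v = 0.
Proof. by rewrite /asm_mult mult_irr subnn. Qed.

Definition sandpile : asm := Asm bot asm_init asm_mult_sym asm_mult_irr.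

Local Notation D := (asm_cfg sandpile).

Lemma sum_bot_diff v : v != bot ->
  \sum_(w < nvert C) ((v == bot) - (w == bot) + ((w == bot) - (v == bot))) = 1.
Proof.
move=> /negPf->; rewrite (bigD1 bot) //= eqxx big1 // => w /negPf->.
by [].
Qed.

Lemma outdeg_sandpile v : v != bot ->
  @outdeg D v = (\sum_(u < nvert C) mult u v + 1) * M v.
Proof.
move=> vb; rewrite /outdeg /= (negPf vb).
under eq_bigr => w _ do rewrite /asm_mult -addnA.
rewrite big_split /= sum_bot_diff // big_split /=.
rewrite -big_distrl /= mulnDl mul1n {3}weightE.
by rewrite addnAC [RHS]addnC [1 + _]addnC.
Qed.

Lemma outdeg_sandpile_bot : @outdeg D bot = 0.
Proof. by rewrite /outdeg /= eqxx big1. Qed.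

Lemma weight_gt0 v : 0 < M v.
Proof. by rewrite weightE. Qed.

(* In the sandpile the chips that v receives from its successors amount to
   less than M v, so that they never change the integer part of the number of
   chips divided by M v. *)
Lemma fireable_sandpile vs v : legal (init C) vs -> @legal D (init D) vs ->
  fireable (fire_seq (init C) vs) v = @fireable D (@fire_seq D (init D) vs) v.
Proof.
move=> lC lD; have [uvs bvs] := legal_uniq lC.
case: (eqVneq v bot) => [->|vb]; first by rewrite /fireable outdeg_bot outdeg_sandpile_bot.
have chipsD := @fire_seq_chips D _ _ v lD.
have sumD : \sum_(u <- vs) @mult D u v =
    (\sum_(u <- vs) mult u v) * M v + \sum_(u <- vs) mult v u * M u.
  rewrite big_distrl -big_split /=; apply: eq_big_seq => u uvs'.
  have /negPf ub : u != bot by apply: contraNneq bvs => <-.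
  by rewrite ub /asm_mult ub (negPf vb) !addn0.
have sub_sum (F : vertex C -> nat) : \sum_(u <- vs) F u <= \sum_(u < nvert C) F u.
  rewrite sum_seq_count leq_sum // => u _; rewrite count_uniq_mem //.
  by case: (u \in vs); rewrite ?mul1n.
have noise : \sum_(u <- vs) mult v u * M u < M v.
  by rewrite [ltnRHS]weightE ltnS sub_sum.
have ins := sub_sum (fun u => mult u v).
have thr := threshold_le_indeg vb.
have Mv := weight_gt0 v.
move: chipsD; rewrite sumD /= ffunE.
have dD := outdeg_sandpile vb.
have dD0 : 0 < @outdeg D v by rewrite dD muln_gt0 addn1 weight_gt0.
rewrite /fireable dD0 outdeg_gt0 //= dD {dD dD0 sumD sub_sum}.
have chipsC := fire_seq_chips v lC; move: chipsC.
rewrite !count_uniq_mem //; case: (boolP (v \in vs)) => v_vs; last first.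
  rewrite !mul0n !addn0 => -> ->.
  set X := \sum_(u <- vs) mult u v in ins *.
  set N := \sum_(u <- vs) mult v u * M u in noise *.
  set I := \sum_(u < nvert C) mult u v in ins thr *.
  move: (outdeg v) (init C v) thr => d i thr.
  have th : d - i <= I by lia.
  have -> : (d <= i + X) = (d - i <= X) by lia.
  move: (d - i) th => {d i thr} th le_th.
  case: (leqP th X) => hX; apply/esym.
    apply/idP; rewrite addnA -mulnDl; apply: leq_trans (leq_addr _ _).
    by rewrite leq_mul2r; apply/orP; right; lia.
  apply/negbTE; rewrite -ltnNge.
  apply: (@leq_trans ((I + 1 - th) * M v + (X * M v + M v))); first by lia.
  by rewrite -[in X in _ + (_ + X)](mul1n (M v)) -!mulnDl leq_mul2r; apply/orP; right; lia.
rewrite !mul1n => cC cD; apply/idP/idP.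
  move=> dv; have : legal (init C) (rcons vs v).
    by rewrite legal_rcons lC /fireable outdeg_gt0.
  by case/legal_uniq; rewrite rcons_uniq v_vs.
move=> le_d; exfalso.
move: le_d cD ins noise.
set X := \sum_(u <- vs) mult u v.
set N := \sum_(u <- vs) mult v u * M u.
set I := \sum_(u < nvert C) mult u v => le_d cD ins noise.
have : (I + 1 - (outdeg v - init C v)) * M v <= (I + 1) * M v by rewrite leq_mul2r leq_subr orbT.
have : X * M v <= I * M v by rewrite leq_mul2r ins orbT.
lia.
Qed.

Lemma legal_sandpile vs : @legal D (init D) vs = legal (init C) vs.
Proof.
elim/last_ind: vs => // vs v IH; rewrite !legal_rcons IH.
case: (boolP (legal (init C) vs)) => //= lvs.
by rewrite fireable_sandpile // IH.
Qed.

Lemma final_sandpile (es : seq (vertex C)) : @execution C es -> @final D (@fire_seq D (init D) es).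
Proof.
move=> [les fin] v; apply/negP => fv; have /negP[] := fin v.
have lD : @legal D (init D) es by rewrite legal_sandpile.
exact: etrans (fireable_sandpile v les lD) fv.
Qed.

Definition chips_after (s : config C) (S : {set vertex C}) :=
  (bot \notin S) &&
  [forall u, s u + (u \in S) * outdeg u == init C u + \sum_(v in S) mult v u].

Lemma chips_after_inj s S S' : chips_after s S -> chips_after s S' -> S = S'.
Proof.
move=> /andP[bS /forallP eqS] /andP[bS' /forallP eqS']; apply/setP.
pose A := [pred v | (v \in S) != (v \in S')].
case: (pickP A) => [v0 Av0|A0 v]; last by have /negbFE/eqP := A0 v.
have [|v Av hv] := @acyclic_maximal _ (fun u v => 0 < mult v u) A v0 _ Av0.
  move=> vs vs0; rewrite -rev_cycle; apply: acyclic_C.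
  by rewrite -size_eq0 size_rev size_eq0.
have vb : v != bot.
  by apply: contraTneq Av => ->; rewrite inE (negPf bS) (negPf bS').
have eq_sum : \sum_(w in S) mult w v = \sum_(w in S') mult w v.
  rewrite [LHS]big_mkcond [RHS]big_mkcond; apply: eq_bigr => w _.
  have := hv w; rewrite [w \in A]inE -leqNgt leqn0.
  by case: (w \in S) (w \in S') => -[] // /(_ isT)/eqP.
have := eqP (eqS v); have := eqP (eqS' v); rewrite eq_sum => <- /addnI.
move: Av; rewrite inE; have := outdeg_gt0 vb.
by case: (v \in S) (v \in S') => -[] //; lia.
Qed.

Lemma sum_uniq_set (F : vertex C -> nat) vs : uniq vs ->
  \sum_(v <- vs) F v = \sum_(v in [set v in vs]) F v.
Proof. by move=> uvs; rewrite big_uniq //; apply: eq_bigl => v; rewrite inE. Qed.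

Lemma chips_after_legal vs : legal (init C) vs ->
  chips_after (fire_seq (init C) vs) [set v in vs].
Proof.
move=> lvs; have [uvs bvs] := legal_uniq lvs.
rewrite /chips_after inE bvs; apply/forallP => u; rewrite inE -sum_uniq_set //.
by rewrite -fire_seq_chips // count_uniq_mem.
Qed.

Lemma fire_seq_inj vs ws : legal (init C) vs -> legal (init C) ws ->
  fire_seq (init C) vs = fire_seq (init C) ws -> vs =i ws.
Proof.
move=> lvs lws eq_s v.
have := chips_after_legal lws; rewrite -eq_s.
by move/(chips_after_inj (chips_after_legal lvs))/setP/(_ v); rewrite !inE.
Qed.

Lemma fire_seq_eq (E : cfg) (s : config E) (vs ws : seq (vertex E)) :
  legal s vs -> legal s ws -> perm_eq vs ws -> fire_seq s vs = fire_seq s ws.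
Proof.
move=> lvs lws vws; apply/ffunP => u; apply/eqP.
rewrite -(eqn_add2r (count_mem u vs * outdeg u)) fire_seq_chips //.
by rewrite (permP vws) fire_seq_chips // (perm_big _ vws).
Qed.

Lemma fire_seq_sandpile_sub vs ws : legal (init C) vs -> legal (init C) ws ->
  @fire_seq D (init D) vs = @fire_seq D (init D) ws -> {subset vs <= ws}.
Proof.
move=> lvs lws eq_s v v_vs; apply/negPn/negP => v_ws.
have [uvs bvs] := legal_uniq lvs; have [uws _] := legal_uniq lws.
have vb : v != bot by apply: contraNneq bvs => <-.
have := @fire_seq_chips D (init D) vs v; rewrite legal_sandpile => /(_ lvs).
have := @fire_seq_chips D (init D) ws v; rewrite legal_sandpile => /(_ lws).
rewrite -eq_s !count_uniq_mem // v_vs (negPf v_ws) mul0n addn0 mul1n => ->.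
have : \sum_(u <- vs) @mult D u v < @outdeg D v.
  rewrite sum_seq_count /outdeg /= (negPf vb) [ltnRHS](bigD1 bot) //=.
  rewrite [X in X < _](bigD1 bot) //= eqxx muln0 add0n.
  apply: (@leq_ltn_trans (\sum_(u < nvert C | u != bot) asm_mult u v)).
    apply: leq_sum => u /negPf->; rewrite count_uniq_mem //.
    by case: (u \in vs); rewrite ?mul1n.
  under [X in X < _]eq_bigr => u _ do rewrite asm_mult_sym.
  by rewrite -[ltnLHS]add0n ltn_add2r /asm_mult (negPf vb) eqxx; lia.
by move=> lt_sum; rewrite -addnA => /addnI eq_sum; move: lt_sum; rewrite -eq_sum ltnNge leq_addl.
Qed.

Lemma fire_seq_sandpile_inj vs ws : legal (init C) vs -> legal (init C) ws ->
  @fire_seq D (init D) vs = @fire_seq D (init D) ws ->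
  fire_seq (init C) vs = fire_seq (init C) ws.
Proof.
move=> lvs lws eq_s; apply: fire_seq_eq => //.
apply: uniq_perm; [exact: (legal_uniq lvs).1 | exact: (legal_uniq lws).1 |].
by move=> v; apply/idP/idP; [|move: eq_s => /esym eq_s]; apply: fire_seq_sandpile_sub eq_s v.
Qed.

Definition sandpile_config (s : config C) : config D :=
  let S := odflt set0 [pick S | chips_after s S] in
  [ffun u => asm_init u + \sum_(v in S) @mult D v u - (u \in S) * @outdeg D u].

Lemma sandpile_configE vs : legal (init C) vs ->
  sandpile_config (fire_seq (init C) vs) = @fire_seq D (init D) vs.
Proof.
move=> lvs; apply/ffunP => u; rewrite ffunE.
have [uvs _] := legal_uniq lvs.
case: pickP => [S|/(_ [set v in vs])]; last by rewrite chips_after_legal.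
move/(chips_after_inj (chips_after_legal lvs)) => <- /=; rewrite inE.
have := @fire_seq_chips D (init D) vs u; rewrite legal_sandpile => /(_ lvs).
rewrite count_uniq_mem // -sum_uniq_set // => /= <-.
by rewrite addnK.
Qed.

Lemma sandpile_equivalent : equivalent C D.
Proof.
split; first by case: simple_C.
  have [es exe] := execution_exists; exists (@fire_seq D (init D) es).
    by exists es => //; rewrite legal_sandpile; case: exe.
  exact: final_sandpile.
exists sandpile_config; split.
- move=> s [vs lvs <-]; rewrite sandpile_configE //.
  by exists vs => //; rewrite legal_sandpile.
- move=> s s' [vs lvs <-] [ws lws <-]; rewrite !sandpile_configE //.
  exact: fire_seq_sandpile_inj.
- move=> t [vs lvs <-]; rewrite legal_sandpile in lvs.
  by exists (fire_seq (init C) vs); [exists vs | rewrite sandpile_configE].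
move=> s s' [vs lvs <-] [ws lws <-]; rewrite !sandpile_configE //; split.
- move=> [xs lxs eq_xs].
  have lvx : legal (init C) (vs ++ xs) by rewrite legal_cat lvs.
  exists xs; first by move: lvx; rewrite -legal_sandpile legal_cat => /andP[].
  have := sandpile_configE lvx; rewrite /fire_seq foldl_cat -/(fire_seq _ _) eq_xs.
  by rewrite sandpile_configE // foldl_cat.
- move=> [xs lxs eq_xs].
  have lvx : legal (init C) (vs ++ xs) by rewrite -legal_sandpile legal_cat legal_sandpile lvs.
  exists xs; first by move: lvx; rewrite legal_cat => /andP[].
  have -> : fire_seq (fire_seq (init C) vs) xs = fire_seq (init C) (vs ++ xs).
    by rewrite /fire_seq foldl_cat.
  by apply: fire_seq_sandpile_inj => //; rewrite -eq_xs /fire_seq foldl_cat.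
Qed.

End Weights.

Lemma enumeration_exists :
  exists cs : seq (config C), enumerates_space cs /\ nvert C <= size cs.
Proof.
pose cs := undup [seq fire_seq (init C) bs | bs : (nvert C).-bseq (vertex C) in
                    [pred bs : (nvert C).-bseq (vertex C) | legal (init C) bs]].
have csP s : s \in cs <-> in_space s.
  rewrite mem_undup; split=> [/imageP[bs]|[vs lvs <-]].
    by rewrite inE => lbs ->; exists bs.
  have le_vs : size vs <= nvert C.
    by rewrite -[leqRHS]card_ord -(card_uniqP (legal_uniq lvs).1) max_card.
  by apply/imageP; exists (Bseq le_vs).
exists cs; split; first by split; [exact: undup_uniq|].
have [es exe] := execution_exists; have [les _] := exe.
pose L := [seq fire_seq (init C) (take k es) | k <- iota 0 (size es).+1].
have l_take k : legal (init C) (take k es).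
  by move: les; rewrite -{1}(cat_take_drop k es) legal_cat => /andP[].
have uL : uniq L.
  rewrite map_inj_in_uniq ?iota_uniq // => k l; rewrite !mem_iota !add0n /= !ltnS => le_k le_l.
  move=> /(fire_seq_inj (l_take k) (l_take l)) eq_kl.
  have := perm_size (uniq_perm (legal_uniq (l_take k)).1 (legal_uniq (l_take l)).1 eq_kl).
  by rewrite !size_takel.
have subL : {subset L <= cs}.
  by move=> s /mapP[k _ ->]; apply/csP; exists (take k es).
apply: leq_trans (uniq_leq_size uL subL); rewrite size_map size_iota.
rewrite -[leqLHS]card_ord cardE -[leqRHS]/(size (bot :: es)).
apply: uniq_leq_size (enum_uniq _) _ => v _; rewrite inE.
by case: (eqVneq v bot) => //= vb; apply: execution_mem.
Qed.

End Equivalence.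

(** * Encodings *)

Lemma nth_allpairs (S T R : Type) (f : S -> T -> R) x0 y0 z0 s t i j :
  i < size s -> j < size t ->
  nth z0 [seq f x y | x <- s, y <- t] (i * size t + j) = f (nth x0 s i) (nth y0 t j).
Proof.
elim: s i => //= x s IH [|i] lt_i lt_j; rewrite nth_cat size_map.
  by rewrite mul0n lt_j (nth_map y0).
rewrite ltnNge mulSn -addnA leq_addr addKn; exact: IH.
Qed.

Section Encoding.
Variables (n : nat) (f : 'I_n -> nat) (g : 'I_n -> 'I_n -> nat).

Let code := [seq f v | v <- enum 'I_n] ++ [seq g u v | u <- enum 'I_n, v <- enum 'I_n].

Lemma size_code : size code = n + n * n.
Proof. by rewrite size_cat size_map size_allpairs size_enum_ord. Qed.

Lemma nth_code_vertex (v : 'I_n) : nth 0 code v = f v.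
Proof.
rewrite nth_cat size_map size_enum_ord ltn_ord (nth_map v) ?size_enum_ord //.
by rewrite nth_ord_enum.
Qed.

Lemma nth_code_edge (u v : 'I_n) : nth 0 code (n + (u * n + v)) = g u v.
Proof.
rewrite nth_cat size_map size_enum_ord ltnNge leq_addr addKn.
have := nth_allpairs (s := enum 'I_n) (t := enum 'I_n) (i := u) (j := v) g u v 0.
by rewrite size_enum_ord !nth_ord_enum; apply.
Qed.
End Encoding.

Theorem theorem4 :
  exists (p : prog) (c : nat),
  forall (C : cfg) (bot : vertex C),
    simple C ->
    acyclic C ->
    (forall v : vertex C, is_sink v <-> v = bot) ->
    (forall v : vertex C, v <> bot ->
       exists2 vs : seq (vertex C), execution vs & v \in vs) ->
  exists (t : nat) (m : state) (A : asm) (cs : seq (config C)),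
    [/\ exec p (input_state (encode_cfg C)) t m,
        has_output m (encode_asm A),
        equivalent C (asm_cfg A),
        enumerates_space cs &
        t <= c * space_size cs].
Proof.
exists translate, translate_cost => C bot simple_C acyclic_C sink_bot all_fired.
set inp := nth 0 (encode_cfg C); set n := nvert C.
have initE (v : 'I_n) : iinit inp v = init C v.
  by rewrite /iinit /inp addn1 /= nth_code_vertex.
have multE (u v : 'I_n) : imult n inp u v = mult u v.
  by rewrite /imult /inp addn1 addSn /= nth_code_edge.
have rowE (v : 'I_n) : row n (imult n inp) v = outdeg v.
  by rewrite /row; apply: eq_bigr => w _; apply: multE.
have sinkE v : v < n -> (row n (imult n inp) v == 0) = (v == bot).
  move=> vn; have := rowE (Ordinal vn); rewrite /= => ->.
  have [to_bot from_bot] := sink_bot (Ordinal vn).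
  apply/idP/eqP => [/to_bot <- //|v_bot]; apply: from_bot; exact: val_inj.
have sourceP (U : pred nat) : (exists2 v, v < n & U v) ->
    exists v, [/\ v < n, U v & forall w, w < n -> U w -> imult n inp v w = 0].
  move=> [v0 v0n Uv0].
  have [v Uv hv] := @acyclic_maximal _ _ [pred v : 'I_n | U v] (Ordinal v0n) acyclic_C Uv0.
  exists v; split=> // w wn Uw; have := hv (Ordinal wn) Uw.
  by rewrite -leqNgt leqn0 -multE => /eqP.
have [t [m [M [exec_m le_t weightE out]]]] :=
  translate_correct (n := n) (inp := inp) (bot := bot) erefl (ltn_ord bot) sinkE sourceP.
pose Mo (v : vertex C) := M v.
have weightE' v : Mo v = 1 + \sum_(w < nvert C) mult v w * Mo w.
  rewrite /Mo weightE //; congr (1 + _).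
  by apply: eq_bigr => w _; rewrite multE.
have [cs [enum_cs le_cs]] := enumeration_exists simple_C acyclic_C sink_bot all_fired.
pose A := sandpile bot acyclic_C Mo.
exists t, m, A, cs; split=> //.
- move: out => [[regs_m _] [mO mO1] arr _ edges].
  rewrite /has_output; have -> : reg m 0 = n + 1 + n * n + n + n + n + n
    by apply: (congr1 (head 0) regs_m).
  case=> [|[|i]]; first by rewrite addn0 mO.
    by rewrite mO1.
  rewrite /= !ltnS size_code => lt_i.
  case: (ltnP i n) => [lt_in|le_ni].
    rewrite -[i]/(val (Ordinal lt_in)) nth_code_vertex ffunE.
    have [_ _] := arr i lt_in.
    rewrite lt_in /base_init (initE (Ordinal lt_in)) (rowE (Ordinal lt_in)).
    under eq_bigr => u _ do rewrite (multE u (Ordinal lt_in)).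
    by move=> <-; congr Defs.mem; rewrite /=; lia.
  have [k lt_k ->] : exists2 k, k < n * n & i = n + k by exists (i - n); lia.
  have n_gt0 : 0 < n by case: (n) lt_k.
  have un : k %/ n < n by rewrite ltn_divLR.
  have vn : k %% n < n by rewrite ltn_mod.
  rewrite {2}(divn_eq k n) (nth_code_edge _ _ (Ordinal un) (Ordinal vn)) /asm_mult.
  rewrite -!multE -[_ == bot]/(k %/ n == bot) -[Ordinal vn == bot]/(k %% n == bot).
  by rewrite -/(entry n inp bot M _ _) -edges //; congr Defs.mem; lia.
- exact: sandpile_equivalent.
- apply: leq_trans le_t _; rewrite leq_mul2l /space_size.
  rewrite big_const_seq count_predT iter_addn_0; apply/orP; right; by rewrite leq_mul2l le_cs orbT.
Qed.
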